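(* Let $\Phi^{T^*Q}$ be the cotangent lifted action of an action $\Phi:G\times Q\to Q$ of a Lie group $G$ on the configuration manifold $Q$, and let $H_d^+(q_0,p_1)$ be a discrete right Hamiltonian. If the generalized discrete Lagrangian $R_d(q_0,q_1,p_1)=p_1q_1-H_d^+(q_0,p_1)$ is invariant under the cotangent lifted action $\Phi^{T^*Q}$, then the discrete flow map $F_{H_d^+}:(q_0,p_0)\mapsto(q_1,p_1)$ of the discrete right Hamilton's equations $$p_0=D_1H_d^+(q_0,p_1),\qquad q_1=D_2H_d^+(q_0,p_1)$$ preserves the momentum map $J:T^*Q\to\mathfrak{g}^*$ of the cotangent lifted action, i.e., $F_{H_d^+}^*J=J$.
   Context: One works in canonical coordinates $(q,p)$ on $T^*Q$, where $Q$ is $n$-dimensional (so $Q$ may be regarded as an open subset of $\mathbb{R}^n$ and $p_1q_1=\sum_ip_{1,i}q_1^i$). A discrete right Hamiltonian is a differentiable real-valued function $H_d^+(q_0,p_1)$ of a position and a momentum; it is understood that the discrete right Hamilton's equations define the map $F_{H_d^+}$. $D_1,D_2$ are partial derivatives with respect to the first and second arguments. The cotangent lifted action is, in coordinates, $\Phi^{T^*Q}_g(q,p)=T^*\Phi_{g^{-1}}(q,p)=\left(\Phi_g^i(q),\,p_j\frac{\partial q^j}{\partial\Phi_g^i(q)}\right)$, where $\partial q^j/\partial\Phi^i_g(q)$ is the inverse Jacobian of $\Phi_g$ at $q$. Invariance of $R_d$ means: for all $g\in G$ and all $(q_0,q_1,p_1)$, if $q_0'=\Phi_g(q_0)$ and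 $(q_1',p_1')=\Phi_g^{T^*Q}(q_1,p_1)$, then $R_d(q_0',q_1',p_1')=R_d(q_0,q_1,p_1)$. The momentum map $J:T^*Q\to\mathfrak{g}^*$ is $J(q,p)\cdot\xi=p\cdot\xi_Q(q)$, $\xi\in\mathfrak{g}$, where $\xi_Q(q)=\frac{d}{d\epsilon}\big|_{\epsilon=0}\Phi_{\exp(\epsilon\xi)}(q)$ is the infinitesimal generator of the action and $\mathfrak{g}$ is the Lie algebra of $G$. *)

(* Defs.v *)
From HB Require Import structures.
From mathcomp Require Import all_boot all_order all_algebra.
From mathcomp Require Import all_classical all_reals all_analysis.
Set Implicit Arguments.
Unset Strict Implicit.
Unset Printing Implicit Defensive.
Import Order.TTheory GRing.Theory Num.Theory.
Import numFieldNormedType.Exports.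
Local Open Scope classical_set_scope.
Local Open Scope ring_scope.

(* Only used for U open in a finite-dimensional space, where it is the usual
   notion of a C^k map: f is differentiable on U with C^(k-1) directional
   derivatives. *)
Fixpoint Ck_on (R : realType) (V W : normedModType R) (k : nat) (U : set V)
    (f : V -> W) : Prop :=
  match k with
  | 0 => forall x, U x -> {for x, continuous f}
  | k'.+1 => (forall x, U x -> differentiable f x) /\
             (forall v, Ck_on k' U ('D_v f))
  end.

Definition smooth_on (R : realType) (V W : normedModType R) (U : set V)
    (f : V -> W) : Prop := forall k, Ck_on k U f.

(* Both directions are total functions; only the values of chart_map on
   chart_dom, and of chart_inv on the image chart_cod, are meaningful. *)
Record chart (R : realType) (m : nat) (T : topologicalType) := Chart {
  chart_dom : set T;
  chart_map : T -> 'rV[R]_m;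
  chart_inv : 'rV[R]_m -> T;
  chart_cod := chart_map @` chart_dom;
  chart_dom_open : open chart_dom;
  chart_cod_open : open chart_cod;
  chart_map_continuous : forall x, chart_dom x -> {for x, continuous chart_map};
  chart_inv_continuous : forall u, chart_cod u -> {for u, continuous chart_inv};
  chart_mapK : forall x, chart_dom x -> chart_inv (chart_map x) = x
}.

(* Smoothness, on an open subset U of a normed space, of a map into a space
   with the atlas (c x)_x. *)
Definition smooth_to (R : realType) (m : nat) (T : topologicalType)
    (c : T -> chart R m T) (V : normedModType R) (U : set V) (f : V -> T) : Prop :=
  (forall u, U u -> {for u, continuous f}) /\
  (forall x, smooth_on (U `&` f @^-1` chart_dom (c x)) (chart_map (c x) \o f)).

(* An m-dimensional Lie group. The atlas is presented as a family of charts
   indexed by the points, chart_at x being a chart around x; chart_at_compat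
   says that the transition maps are smooth. *)
HB.mixin Record isLieGroup (R : realType) (m : nat) (G : Type)
    of Group G & Topological G := {
  lie_hausdorff : hausdorff_space G;
  lie_second_countable : @second_countable G;
  chart_at : G -> chart R m G;
  mem_chart_at : forall x : G, chart_dom (chart_at x) x;
  chart_at_compat : forall x : G,
    smooth_to chart_at (chart_cod (chart_at x)) (chart_inv (chart_at x));
  smooth_mulg : forall x y : G,
    smooth_to chart_at (chart_cod (chart_at x) `*` chart_cod (chart_at y))
      (fun uv => chart_inv (chart_at x) uv.1 * chart_inv (chart_at y) uv.2)%g;
  smooth_invg : forall x : G,
    smooth_to chart_at (chart_cod (chart_at x))
      (fun u => (chart_inv (chart_at x) u)^-1)%g
}.

#[short(type="lieGroupType")]
HB.structure Definition LieGroup (R : realType) (m : nat) :=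
  { G of Group G & Topological G & isLieGroup R m G }.

(* The Lie algebra T_1 G, in the coordinates given by the chart at 1. *)
Definition lie_algebra (R : realType) (m : nat) (G : lieGroupType R m) :
  normedModType R := 'rV[R]_m.

Section LieGroupTheory.
Variables (R : realType) (m : nat) (G : lieGroupType R m).

Definition one_parameter_subgroup (gamma : R^o -> G) : Prop :=
  (forall s t : R, gamma (s + t) = (gamma s * gamma t)%g) /\
  smooth_to (@chart_at R m G) [set: R^o] gamma.

Definition has_velocity_at0 (gamma : R^o -> G) (xi : lie_algebra G) : Prop :=
  is_derive (0 : R^o) (1 : R^o) (chart_map (chart_at (1%g : G)) \o gamma) xi.

Definition is_exponential (e : lie_algebra G -> G) : Prop :=
  forall xi : lie_algebra G,
    one_parameter_subgroup (fun t : R => e (t *: xi)) /\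
    has_velocity_at0 (fun t : R => e (t *: xi)) xi.

(* Every Lie group has exactly one map satisfying is_exponential, so the
   default value of xget is never used. *)
Definition lie_exp : lie_algebra G -> G :=
  xget (fun=> 1%g) [set e | is_exponential e].

End LieGroupTheory.

(* Q is an open subset of R^n, and phase_space Q = T^*Q. Positions, velocities
   and momenta are row vectors, and maps are total: only their values on Q,
   resp. T^*Q, are meaningful. *)
Section DiscreteHamiltonian.
Variables (R : realType) (n : nat).
Local Notation E := 'rV[R]_n.
Implicit Types (Q : set E) (H : E * E -> R^o).

Definition phase_space Q : set (E * E) := Q `*` setT.

Definition pairing (p v : E) : R := \sum_(i < n) p ord0 i * v ord0 i.

Definition gradient (f : E -> R^o) (x : E) : E :=
  \row_(i < n) 'D_(delta_mx ord0 i) f x.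

Definition D1 H (q0 p1 : E) : E := gradient (fun q : E => H (q, p1)) q0.
Definition D2 H (q0 p1 : E) : E := gradient (fun p : E => H (q0, p)) p1.

Definition discrete_right_hamiltonian Q H : Prop :=
  forall z, phase_space Q z -> differentiable H z.

Definition discrete_right_hamilton_eqs H (z0 z1 : E * E) : Prop :=
  z0.2 = D1 H z0.1 z1.2 /\ z1.1 = D2 H z0.1 z1.2.

(* The equations define F as a map from A to B. For a globally defined flow,
   A = B = phase_space Q; smaller A and B allow for the case where the
   equations are only locally (uniquely) solvable. *)
Definition discrete_flow_map Q H (A B : set (E * E)) (F : E * E -> E * E) :
    Prop :=
  [/\ A `<=` phase_space Q, B `<=` phase_space Q &
      forall z0, A z0 ->
        B (F z0) /\
        forall z1, B z1 -> (discrete_right_hamilton_eqs H z0 z1 <-> z1 = F z0)].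

Definition generalized_discrete_lagrangian H (q0 q1 p1 : E) : R :=
  pairing p1 q1 - H (q0, p1).

Section Action.
Variables (m : nat) (G : lieGroupType R m).
Implicit Type Phi : G -> E -> E.

Definition lie_group_action Q Phi : Prop :=
  [/\ forall g q, Q q -> Q (Phi g q),
      forall q, Q q -> Phi 1%g q = q,
      forall g h q, Q q -> Phi (g * h)%g q = Phi g (Phi h q) &
      forall x : G, smooth_on (chart_cod (chart_at x) `*` Q)
        (fun uq => Phi (chart_inv (chart_at x) uq.1) uq.2)].

(* 'J f q acts on row vectors from the right, so its (j, i) entry is the j-th
   partial derivative of f^i and (invmx ('J (Phi g) q)) i j is the derivative
   of q^j with respect to Phi_g^i(q); hence the transpose. *)
Definition cotangent_lift Phi (g : G) (z : E * E) : E * E :=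
  (Phi g z.1, z.2 *m (invmx ('J (Phi g) z.1))^T).

Definition invariant_under_cotangent_lift Q Phi (Rd : E -> E -> E -> R) :
    Prop :=
  forall (g : G) (q0 q1 p1 : E), Q q0 -> Q q1 ->
    Rd (Phi g q0) (cotangent_lift Phi g (q1, p1)).1
       (cotangent_lift Phi g (q1, p1)).2 = Rd q0 q1 p1.

Definition infinitesimal_generator Phi (xi : lie_algebra G) (q : E) : E :=
  derive1 (fun t : R => Phi (lie_exp (t *: xi)) q) 0.

(* The element J(q, p) of the dual of the Lie algebra, as a function on it. *)
Definition momentum_map Phi (z : E * E) : lie_algebra G -> R :=
  fun xi => pairing z.2 (infinitesimal_generator Phi xi z.1).

End Action.
End DiscreteHamiltonian.

(* Main.v *)
(* Let g_t = exp(t xi) and let P t be the momentum at q1 that the cotangent lift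
   of g_t carries to p1. Invariance of R_d at (q0, q1, P t) reads
     p1 . Phi(g_t, q1) - H(Phi(g_t, q0), p1) = P t . q1 - H(q0, P t).
   At t = 0 the right-hand side is stationary, since q1 = D2 H(q0, p1), while the
   derivative of the left-hand side is p1 . xi_Q(q1) - D1 H(q0, p1) . xi_Q(q0);
   with p0 = D1 H(q0, p1) this is the conservation of J. *)
Require Import Defs.
From HB Require Import structures.
From mathcomp Require Import all_boot all_order all_algebra.
From mathcomp Require Import all_classical all_reals all_analysis.
Set Implicit Arguments.
Unset Strict Implicit.
Unset Printing Implicit Defensive.
Import Order.TTheory GRing.Theory Num.Theory.
Import numFieldNormedType.Exports.
Local Open Scope classical_set_scope.
Local Open Scope ring_scope.


Lemma pairingC (R : realType) (n : nat) (p v : 'rV[R]_n) :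
  pairing p v = pairing v p.
Proof. by apply: eq_bigr => i _; rewrite mulrC. Qed.

Lemma pairing_is_linear (R : realType) (n : nat) (p : 'rV[R]_n) :
  linear (pairing p : 'rV[R]_n -> R^o).
Proof.
move=> a u v; rewrite /pairing scaler_sumr -big_split /=.
by apply: eq_bigr => i _; rewrite !mxE mulrDr mulrCA.
Qed.

HB.instance Definition _ (R : realType) (n : nat) (p : 'rV[R]_n) :=
  GRing.isLinear.Build R 'rV[R]_n R^o _ (pairing p : 'rV[R]_n -> R^o)
    (@pairing_is_linear R n p).

Lemma pairing_delta (R : realType) (n : nat) (p : 'rV[R]_n) (i : 'I_n) :
  pairing p (delta_mx ord0 i) = p ord0 i.
Proof.
rewrite /pairing (bigD1 i) //= mxE !eqxx mulr1 big1 ?addr0 // => j ji.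
by rewrite mxE eqxx (negbTE ji) mulr0.
Qed.

Lemma pairing_continuous (R : realType) (n : nat) (p : 'rV[R]_n) :
  continuous (pairing p : 'rV[R]_n -> R^o).
Proof.
move=> v; rewrite (_ : (pairing p : 'rV[R]_n -> R^o) =
    \sum_(i < n) (p ord0 i *: (fun w : 'rV[R]_n => w ord0 i : R^o))).
  apply/differentiable_continuous/differentiable_sum => i.
  exact/differentiableZ/differentiable_coord.
by apply/funext => w; rewrite fct_sumE.
Qed.

#[global] Instance is_diff_pairing (R : realType) (n : nat) (p v : 'rV[R]_n) :
  is_diff v (pairing p : 'rV[R]_n -> R^o) (pairing p : 'rV[R]_n -> R^o).
Proof.
have cp := @pairing_continuous R n p.
by apply: DiffDef; [exact: linear_differentiable|exact: diff_lin].
Qed.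

(** A differential is linear, hence determined by its values on the basis vectors, which are the
    partial derivatives. This turns Hamilton's equations, written with [D1] and [D2], into
    statements about differentials. *)
Lemma is_diff_gradient (R : realType) (n : nat) (f : 'rV[R]_n -> R^o)
    (x : 'rV[R]_n) :
  differentiable f x -> is_diff x f (pairing (gradient f x) : 'rV[R]_n -> R^o).
Proof.
move=> fx; apply: DiffDef => //; apply/funext => v.
rewrite {1}(row_sum_delta v) linear_sum; apply: eq_bigr => i _.
by rewrite linearZ /= -deriveE // mxE mulrC.
Qed.

(** Chain rule for [g \o f], which is the identity near [x]. Jacobians act on row vectors from the
    right, so the one of [f] is the left factor. *)
Lemma jacobian_unitmx (R : realType) (n : nat) (f g : 'rV[R]_n -> 'rV[R]_n)
    (x : 'rV[R]_n) :
  differentiable f x -> differentiable g (f x) ->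
  (\near x, g (f x) = x) -> 'J f x \in unitmx.
Proof.
move=> fx gfx gfK.
have JK : 'J f x *m 'J g (f x) = 1%:M; last by have [+ _] := mulmx1_unit JK.
apply/row_matrixP => i; rewrite !rowE mulmx1 mulmxA /jacobian !mul_rV_lin1.
have := congr1 (@^~ (delta_mx 0 i)) (diff_comp fx gfx) => /= <-.
rewrite -deriveE; last exact: differentiable_comp.
by rewrite (near_eq_derive (g := id)) // derive_id.
Qed.

(** The two difference quotients coincide. Derivatives of a single [Phi g] thus become directional
    derivatives of the action in group coordinates and position jointly, whose smoothness is
    known. *)
Lemma derive_pair2 (R : realType) (U V W : normedModType R) (f : U * V -> W)
    (u : U) (x v : V) :
  'D_(0, v) f (u, x) = 'D_v (fun y => f (u, y)) x.
Proof.
rewrite /derive; set d := (fun h => _); set d' := (fun h => _).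
suff -> : d = d' by []; apply/funext => h; rewrite /d /d' /=.
by rewrite -[h *: (0, v) + (u, x)]/(h *: 0 + u, h *: v + x) scaler0 add0r.
Qed.

(** The pull-back of the covector [p] along [f], written entrywise so that it can be differentiated
    in a parameter. *)
Lemma mulmx_jacobianT (R : realType) (n : nat) (f : 'rV[R]_n -> 'rV[R]_n)
    (p x : 'rV[R]_n) :
  differentiable f x ->
  p *m ('J f x)^T = \row_k pairing p ('D_(delta_mx ord0 k) f x).
Proof.
move=> fx; apply/rowP => k; rewrite !mxE; apply: eq_bigr => j _.
by rewrite deriveEjacobian // -rowE !mxE.
Qed.

Definition chart_action (R : realType) (n m : nat) (G : lieGroupType R m)
    (Phi : G -> 'rV[R]_n -> 'rV[R]_n) (x : G) (w : 'rV[R]_m * 'rV[R]_n) :=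
  Phi (chart_inv (chart_at x) w.1) w.2.

Lemma chart_actionE (R : realType) (n m : nat) (G : lieGroupType R m)
    (Phi : G -> 'rV[R]_n -> 'rV[R]_n) (x g : G) :
  chart_dom (chart_at x) g ->
  Phi g = fun q => chart_action Phi x (chart_map (chart_at x) g, q).
Proof. by move=> xg; apply/funext => q; rewrite /chart_action /= chart_mapK. Qed.

Lemma action_differentiable (R : realType) (n m : nat) (G : lieGroupType R m)
    (Q : set 'rV[R]_n) (Phi : G -> 'rV[R]_n -> 'rV[R]_n) (g : G)
    (q : 'rV[R]_n) :
  lie_group_action Q Phi -> Q q -> differentiable (Phi g) q.
Proof.
move=> [_ _ _ /(_ g) /(_ 1)[dPhi _]] Qq.
have gg := mem_chart_at g.
rewrite (chart_actionE Phi gg).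
apply: (@differentiable_comp _ _ _ _
  (fun q => (chart_map (chart_at g) g, q)) (chart_action Phi g)).
  by apply: differentiable_pair; [exact: differentiable_cst|].
by apply: dPhi; split => //=; exists g.
Qed.

(** [Phi g^-1] inverts [Phi g] on [Q], which is a neighbourhood of each of its points. *)
Lemma action_jacobian_unitmx (R : realType) (n m : nat) (G : lieGroupType R m)
    (Q : set 'rV[R]_n) (Phi : G -> 'rV[R]_n -> 'rV[R]_n) (g : G)
    (q : 'rV[R]_n) :
  open Q -> lie_group_action Q Phi -> Q q -> 'J (Phi g) q \in unitmx.
Proof.
move=> oQ aPhi Qq; have [QPhi Phi1 PhiM _] := aPhi.
apply: (@jacobian_unitmx _ _ _ (Phi g^-1%g)).
- exact: action_differentiable Qq.
- exact: action_differentiable (QPhi _ _ Qq).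
have : \near q, Q q by exact: open_nbhs_nbhs.
by apply: filterS => x Qx; rewrite -PhiM // mulVg Phi1.
Qed.

Lemma near_chart_dom (R : realType) (m : nat) (G : lieGroupType R m)
    (gamma : R^o -> G) (t0 : R^o) :
  {for t0, continuous gamma} ->
  \forall t \near t0, chart_dom (chart_at (gamma t0)) (gamma t).
Proof.
move=> cgamma; apply: cgamma; apply: open_nbhs_nbhs; split.
  exact: chart_dom_open.
exact: mem_chart_at.
Qed.

(** Only the first-order behaviour at 0 of a curve through 1 enters, so [gamma] is any such curve;
    [theorem4] takes the exponential one. *)
Lemma momentum_conservation (R : realType) (n m : nat) (G : lieGroupType R m)
    (Q : set 'rV[R]_n) (Phi : G -> 'rV[R]_n -> 'rV[R]_n)
    (H : 'rV[R]_n * 'rV[R]_n -> R^o) (gamma : R^o -> G) (q0 q1 p1 : 'rV[R]_n) :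
  open Q -> lie_group_action Q Phi -> discrete_right_hamiltonian Q H ->
  invariant_under_cotangent_lift Q Phi (generalized_discrete_lagrangian H) ->
  gamma 0 = 1%g -> {for (0 : R^o), continuous gamma} ->
  derivable (chart_map (chart_at (1%g : G)) \o gamma) (0 : R^o) 1 ->
  Q q0 -> Q q1 -> q1 = D2 H q0 p1 ->
  pairing p1 ('D_1 (fun t : R^o => Phi (gamma t) q1) (0 : R^o)) =
  pairing (D1 H q0 p1) ('D_1 (fun t : R^o => Phi (gamma t) q0) (0 : R^o)).
Proof.
move=> oQ aPhi dH invR gamma0 cgamma du Qq0 Qq1 q1E.
have [QPhi Phi1 PhiM sPhi] := aPhi.
pose u : R^o -> 'rV[R]_m := chart_map (chart_at (1%g : G)) \o gamma.
pose f := chart_action Phi (1%g : G).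
have u_cod : chart_cod (chart_at (1%g : G)) (u 0).
  by exists 1%g; [exact: mem_chart_at|rewrite /u /= gamma0].
have {}du : differentiable u (0 : R^o) by apply/derivable1_diffP.
have dpair q : differentiable (fun t : R^o => (u t, q)) (0 : R^o).
  by apply: differentiable_pair => //; exact: differentiable_cst.
pose X q : R^o -> 'rV[R]_n := fun t => f (u t, q).
have fE : \forall t \near (0 : R^o), Phi (gamma t) = fun q => X q t.
  have := near_chart_dom cgamma; rewrite gamma0.
  by apply: filterS => t /(chart_actionE Phi).
have X0 q : Q q -> X q 0 = q.
  by move=> Qq; rewrite -[RHS]Phi1 // -gamma0 (nbhs_singleton fE).
have dX q : Q q -> differentiable (X q) (0 : R^o).
  move=> Qq; apply: (@differentiable_comp _ _ _ _ (fun t => (u t, q)) f) => //.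
  by have [+ _] := sPhi 1%g 1; apply; split.
have XE q : Q q -> 'D_1 (fun t : R^o => Phi (gamma t) q) (0 : R^o) =
    'd (X q) (0 : R^o) 1.
  move=> Qq; rewrite -deriveE; last exact: dX.
  by apply: near_eq_derive; apply: filterS fE => t ->.
rewrite (XE _ Qq0) (XE _ Qq1).
(* P t is the pull-back of p1 along Phi (gamma t), i.e. the momentum at q1 that
   the cotangent lift carries to the constant p1; so no inverse Jacobian has to
   be differentiated. *)
pose P : R^o -> 'rV[R]_n :=
  fun t => \row_k pairing p1 ('D_(0, delta_mx ord0 k) f (u t, q1)).
have dP : differentiable P (0 : R^o).
  apply/derivable1_diffP/derivable_mxP => i k.
  rewrite [X in derivable X](_ : _ = (pairing p1 : _ -> R^o) \o
    ('D_(0, delta_mx ord0 k) f \o (fun t => (u t, q1)))); last first.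
    by apply/funext => t; rewrite mxE.
  apply/derivable1_diffP; apply: differentiable_comp; last first.
    exact: ex_diff.
  apply: differentiable_comp => //.
  (* The entries of [P] already contain a first derivative of the action, hence smoothness of order
     2. *)
  have [_ /(_ (0, delta_mx ord0 k))[+ _]] := sPhi 1%g 2.
  by apply; split.
have PE : \forall t \near (0 : R^o), P t = p1 *m ('J (Phi (gamma t)) q1)^T.
  apply: filterS fE => t Et.
  rewrite mulmx_jacobianT; last exact: action_differentiable Qq1.
  by apply/rowP => k; rewrite !mxE derive_pair2 Et.
have P0 : P 0 = p1.
  apply/rowP => k; rewrite mxE derive_pair2 (near_eq_derive (g := id)).
    by rewrite derive_id pairing_delta.
  have : \near q1, Q q1 by exact: open_nbhs_nbhs.
  by apply: filterS => q /X0.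
pose phi0 := fun q : 'rV[R]_n => H (q, p1).
pose phi1 := fun p : 'rV[R]_n => H (q0, p).
have dphi0 : differentiable phi0 q0.
  apply: (@differentiable_comp _ _ _ _ (fun q => (q, p1)) H).
    by apply: differentiable_pair; last exact: differentiable_cst.
  exact: dH.
have dphi1 : differentiable phi1 p1.
  apply: (@differentiable_comp _ _ _ _ (fun p => (q0, p)) H).
    by apply: differentiable_pair; first exact: differentiable_cst.
  exact: dH.
have invE : \forall t \near (0 : R^o),
    pairing p1 (X q1 t) - phi0 (X q0 t) = pairing q1 (P t) - phi1 (P t).
  near=> t.
  have Et : Phi (gamma t) = fun q => X q t by near: t.
  have := invR (gamma t) q0 q1 (P t) Qq0 Qq1.
  rewrite /generalized_discrete_lagrangian /= (near PE t) //.
  (* The inverse Jacobian of the lift cancels the Jacobian in [P t], leaving the momentum [p1]. *)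
  rewrite -mulmxA -trmx_mul mulVmx ?trmx1 ?mulmx1; last first.
    exact: action_jacobian_unitmx Qq1.
  rewrite -(near PE t) // Et => ->; congr (_ - _); exact: pairingC.
pose L : R^o -> R^o := (pairing p1 : _ -> R^o) \o X q1 - (phi0 \o X q0).
pose M : R^o -> R^o := (pairing q1 : _ -> R^o) \o P - (phi1 \o P).
have dL : is_diff (0 : R^o) L
   (((pairing p1 : _ -> R^o) \o 'd (X q1) (0 : R^o)) -
    ((pairing (D1 H q0 p1) : _ -> R^o) \o 'd (X q0) (0 : R^o))).
  apply: is_diffB; apply: is_diff_comp.
  - exact/differentiableP/dX.
  - exact/differentiableP/dX.
  - by rewrite X0 //; exact: is_diff_gradient.
have dM : is_diff (0 : R^o) M 0.
  (* Stationarity: the gradient of [phi1] at [P 0 = p1] is [D2 H q0 p1 = q1], so both terms of [M]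
     have this differential. *)
  rewrite -(subrr ((pairing q1 : _ -> R^o) \o 'd P (0 : R^o))).
  apply: is_diffB; apply: is_diff_comp.
  - exact/differentiableP.
  - exact/differentiableP.
  - by rewrite P0 q1E; exact: is_diff_gradient.
have : 'D_1 L (0 : R^o) = 'D_1 M (0 : R^o) by apply: near_eq_derive.
case: dL dM => exL valL [exM valM].
rewrite (deriveE _ exL) (deriveE _ exM) valL valM.
exact: subr0_eq.
Unshelve. all: by end_near.
Qed.

(** Here [lie_exp] is its default, the constant 1, so the curve being differentiated is constant. *)
Lemma infinitesimal_generator_no_exp (R : realType) (n m : nat)
    (G : lieGroupType R m) (Phi : G -> 'rV[R]_n -> 'rV[R]_n)
    (xi : lie_algebra G) (q : 'rV[R]_n) :
  ~ (exists e, @is_exponential R m G e) -> infinitesimal_generator Phi xi q = 0.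
Proof.
move=> noexp; rewrite /infinitesimal_generator /lie_exp xgetPN.
  exact: derive1_cst.
by move=> e expe; apply: noexp; exists e.
Qed.

Theorem theorem4 (R : realType) (n m : nat) (G : lieGroupType R m)
    (Q : set 'rV[R]_n) (Phi : G -> 'rV[R]_n -> 'rV[R]_n)
    (H : 'rV[R]_n * 'rV[R]_n -> R^o)
    (A B : set ('rV[R]_n * 'rV[R]_n))
    (F : 'rV[R]_n * 'rV[R]_n -> 'rV[R]_n * 'rV[R]_n)
    (openQ : open Q)
    (action_Phi : lie_group_action Q Phi)
    (hamiltonian_H : discrete_right_hamiltonian Q H)
    (invariant_Rd : invariant_under_cotangent_lift Q Phi
       (generalized_discrete_lagrangian H))
    (flow_F : discrete_flow_map Q H A B F) :
  forall z, A z -> momentum_map Phi (F z) = momentum_map Phi z.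
Proof.
move=> z Az; have [AQ BQ flow] := flow_F.
(* The equivalence defining the flow, read at [z1 = F z], yields Hamilton's equations for [z] and
   [F z]. *)
have [BFz /(_ _ BFz)[_ /(_ erefl)]] := flow z Az.
have [Qq1 _] := BQ _ BFz; have [Qq0 _] := AQ _ Az.
move=> [p0E q1E]; apply/funext => xi; rewrite /momentum_map.
have [[e0 e0P]|noexp] := pselect (exists e, @is_exponential R m G e); last first.
  by rewrite !infinitesimal_generator_no_exp // !linear0.
have /(_ xi)[[expD [cexp _]] [dexp _]] : is_exponential (@lie_exp R m G).
  exact: (@xgetPex _ (fun=> 1%g) [set e | is_exponential e] (ex_intro _ e0 e0P)).
have exp0 : lie_exp ((0 : R) *: xi) = 1%g.
  (* The value at 0 is idempotent by the homomorphism law, hence 1 by cancellation. *)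
  by apply: (@mulgI _ (lie_exp ((0 : R) *: xi))); rewrite mulg1 -expD addr0.
rewrite /infinitesimal_generator !derive1E p0E.
apply: (momentum_conservation (gamma := fun t : R => lie_exp (t *: xi))
  openQ action_Phi hamiltonian_H invariant_Rd) => //.
exact: cexp.
Qed.
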